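(* Let $\mathbf{k}$ be a unitary commutative ring and $\lambda\in\mathbf{k}$. Let $\mathbf{k}\mathcal{F}$ be the free $\mathbf{k}$-module on planar rooted forests, with product $\diamond$ (depending on $\lambda$), grafting operator $\lfloor\ \rfloor$, and the linear operator $d_{\mathcal{F}}:\mathbf{k}\mathcal{F}\to\mathbf{k}\mathcal{F}$, all as defined in the context. Then the triple $(\mathbf{k}\mathcal{F},d_{\mathcal{F}},\lfloor\ \rfloor)$, with multiplication $\diamond$, is a differential Rota-Baxter algebra of weight $\lambda$.
   Context: A differential Rota-Baxter $\mathbf{k}$-algebra of weight $\lambda$ is an associative unital $\mathbf{k}$-algebra $R$ with $\mathbf{k}$-linear operators $d,P:R\to R$ such that, for all $x,y\in R$: $d(xy)=d(x)y+xd(y)+\lambda d(x)d(y)$; $d(1)=0$; $P(x)P(y)=P(xP(y))+P(P(x)y)+\lambda P(xy)$; and $d\circ P=\mathrm{id}_R$. Forests. Let $\bullet$ be the one-vertex tree and $\mathcal{F}$ the set of planar rooted forests, i.e. non-empty noncommutative concatenations $T_1\sqcup\cdots\sqcup T_b$ ($b\ge1$) of planar rooted trees. For a forest $F=T_1\sqcup\cdots\sqcup T_b$, the grafting $\lfloor F\rfloor$ is the tree obtained by adding a new root joined by an edge to the root of each $T_i$; every tree other than $\bullet$ is $\lfloor\overline F\rfloor$ for a unique forest $\overline F$. On $\mathbf{k}\mathcal{F}$, extend $\sqcup$ bilinearly and $\lfloor\ \rfloor$ linearly. The product $\diamond$ on $\mathbf{k}\mathcal{F}$ is the bilinear product defined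 recursively by: for trees $F,F'$, $F\diamond\bullet=F$, $\bullet\diamond F'=F'$, and $$\lfloor\overline F\rfloor\diamond\lfloor\overline F'\rfloor=\lfloor\overline F\diamond\lfloor\overline F'\rfloor\rfloor+\lfloor\lfloor\overline F\rfloor\diamond\overline F'\rfloor+\lambda\lfloor\overline F\diamond\overline F'\rfloor;$$ for forests, $(T_1\sqcup\cdots\sqcup T_b)\diamond(T'_1\sqcup\cdots\sqcup T'_{b'})=T_1\sqcup\cdots\sqcup T_{b-1}\sqcup(T_b\diamond T'_1)\sqcup T'_2\sqcup\cdots\sqcup T'_{b'}$. It is known that $(\mathbf{k}\mathcal{F},\diamond,\lfloor\ \rfloor)$ is a unitary Rota-Baxter algebra of weight $\lambda$, with unit $1=\bullet$. The operator $d_{\mathcal{F}}$. A forest $F=T_1\sqcup\cdots\sqcup T_b$ with trees $T_i$ can be written $F=T_1\diamond(\bullet\sqcup\bullet)\diamond T_2\diamond(\bullet\sqcup\bullet)\diamond\cdots\diamond(\bullet\sqcup\bullet)\diamond T_b=V_1\diamond V_2\diamond\cdots\diamond V_{2b-1}$, where $V_i=T_{(i+1)/2}$ for $i$ odd and $V_i=\bullet\sqcup\bullet$ for $i$ even. For $V$ equal to a tree or to $\bullet\sqcup\bullet$ put $d_{\mathcal{F}}(\bullet)=0$, $d_{\mathcal{F}}(\bullet\sqcup\bullet)=1=\bullet$, and $d_{\mathcal{F}}(\lfloor\overline V\rfloor)=\overline V$. For a general forest $F=T_1\sqcup\cdots\sqcup T_b$, written as $F=V_1\diamond V_2\diamond\cdots\diamond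 V_{2b-1}$ with $V_i=T_{(i+1)/2}$ for $i$ odd and $V_i=\bullet\sqcup\bullet$ for $i$ even, put $$d_{\mathcal{F}}(F)=\sum_{\emptyset\ne I\subseteq\{1,\dots,2b-1\}}\lambda^{|I|-1}\,V_{I,1}\diamond\cdots\diamond V_{I,2b-1},\qquad V_{I,i}=\begin{cases}V_i,& i\notin I,\\ d_{\mathcal{F}}(V_i),& i\in I,\end{cases}$$ and extend $d_{\mathcal{F}}$ to $\mathbf{k}\mathcal{F}$ by $\mathbf{k}$-linearity. *)

(* Defs.v *)
From HB Require Import structures.
From mathcomp Require Import all_boot all_algebra finmap.
From mathcomp Require Export monalg.

Set Implicit Arguments.
Unset Strict Implicit.
Unset Printing Implicit Defensive.

Import GRing.Theory.
Local Open Scope ring_scope.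

(* A forest is a non-empty list of trees: [Sing T] is T alone, [Cons T F] is
   T followed by F. A tree is the one-vertex tree or the grafting of a
   (necessarily non-empty) forest. *)
Inductive tree := Bullet | Graft of forest
with forest := Sing of tree | Cons of tree & forest.

Scheme tree_forest_ind := Induction for tree Sort Prop
with forest_tree_ind := Induction for forest Sort Prop.
Combined Scheme tree_forest_mutind from tree_forest_ind, forest_tree_ind.

Fixpoint tree_encode (T : tree) : GenTree.tree unit :=
  match T with
  | Bullet => GenTree.Leaf tt
  | Graft F => GenTree.Node 0 [:: forest_encode F]
  end
with forest_encode (F : forest) : GenTree.tree unit :=
  match F with
  | Sing T => GenTree.Node 0 [:: tree_encode T]
  | Cons T F => GenTree.Node 0 [:: tree_encode T; forest_encode F]
  end.

Fixpoint tree_decode (g : GenTree.tree unit) : option tree :=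
  match g with
  | GenTree.Leaf _ => Some Bullet
  | GenTree.Node _ [:: x] => omap Graft (forest_decode x)
  | _ => None
  end
with forest_decode (g : GenTree.tree unit) : option forest :=
  match g with
  | GenTree.Node _ [:: x] => omap Sing (tree_decode x)
  | GenTree.Node _ [:: x; y] =>
      obind (fun T => omap (Cons T) (forest_decode y)) (tree_decode x)
  | _ => None
  end.

Lemma tree_forest_codeK :
  pcancel tree_encode tree_decode * pcancel forest_encode forest_decode.
Proof.
suff [? ?] : (forall T, tree_decode (tree_encode T) = Some T) /\
             (forall F, forest_decode (forest_encode F) = Some F) by [].
by apply: tree_forest_mutind => //= [F ->|T ->|T -> F ->].
Qed.

HB.instance Definition _ :=
  Choice.copy tree (pcan_type tree_forest_codeK.1).
HB.instance Definition _ :=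
  Choice.copy forest (pcan_type tree_forest_codeK.2).

Fixpoint fcat (F F' : forest) : forest :=
  match F with
  | Sing T => Cons T F'
  | Cons T F0 => Cons T (fcat F0 F')
  end.

(* The free k-module on forests. The module structure that monalg puts on
   [{malg k[_]}] requires 1 != 0 in k; it is rebuilt here without this
   restriction. *)
Definition kforest (k : comPzRingType) : Type := {malg k[forest]}.

Section FreeModule.
Variable k : comPzRingType.

HB.instance Definition _ := GRing.Zmodule.copy (kforest k) {malg k[forest]}.

Definition kforest_scale (c : k) (u : kforest k) : kforest k :=
  [malg F in msupp u => c * u@_F].

Lemma kforest_scaleE c (u : kforest k) F : (kforest_scale c u)@_F = c * u@_F.
Proof. by rewrite mcoeffE; case: msuppP; rewrite ?mulr0. Qed.

Lemma kforest_scaleA c1 c2 u :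
  kforest_scale c1 (kforest_scale c2 u) = kforest_scale (c1 * c2) u.
Proof. by apply/malgP=> F; rewrite !kforest_scaleE mulrA. Qed.

Lemma kforest_scale1 : left_id 1 kforest_scale.
Proof. by move=> u; apply/malgP=> F; rewrite kforest_scaleE mul1r. Qed.

Lemma kforest_scaleDr : right_distributive kforest_scale +%R.
Proof.
move=> c u v; apply/malgP=> F.
by rewrite mcoeffD !kforest_scaleE mcoeffD mulrDr.
Qed.

Lemma kforest_scaleDl u :
  {morph kforest_scale^~ u : c1 c2 / c1 + c2}.
Proof.
by move=> c1 c2; apply/malgP=> F; rewrite mcoeffD !kforest_scaleE mulrDl.
Qed.

HB.instance Definition _ := GRing.Zmodule_isLmodule.Build k (kforest k)
  kforest_scaleA kforest_scale1 kforest_scaleDr kforest_scaleDl.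

Definition basis (F : forest) : kforest k := << F >>.

Definition lin_ext (f : forest -> kforest k) (u : kforest k) : kforest k :=
  \sum_(F <- msupp u) u@_F *: f F.

Definition bilin_ext (f : forest -> forest -> kforest k)
    (u v : kforest k) : kforest k :=
  lin_ext (fun F => lin_ext (f F) v) u.

Lemma lin_ext_basis f F : lin_ext f (basis F) = f F.
Proof.
rewrite /lin_ext /basis msuppU; case: eqP => [k0|_].
  by rewrite big_seq_fset0 -[RHS]scale1r k0 scale0r.
by rewrite big_seq_fset1 mcoeffUU scale1r.
Qed.

Lemma bilin_ext_basis f F F' : bilin_ext f (basis F) (basis F') = f F F'.
Proof. by rewrite /bilin_ext !lin_ext_basis. Qed.

Definition sqcup : kforest k -> kforest k -> kforest k :=
  bilin_ext (fun F F' => basis (fcat F F')).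

Definition graft : kforest k -> kforest k :=
  lin_ext (fun F => basis (Sing (Graft F))).

End FreeModule.

Section Diamond.
Variables (k : comPzRingType) (lambda : k).
Local Notation kF := (kforest k).
Local Notation "u '|_|' v" := (sqcup u v) (at level 50, left associativity).

Definition act_first (phi : tree -> kF) (F : forest) : kF :=
  match F with
  | Sing T => phi T
  | Cons T F0 => phi T |_| basis k F0
  end.

(* [diamond_tt T T'] is the product of T and T', and
   [diamond_ft F T'] the product of F and T'; the recursion
   is structural on the left factor, then on the right one. The defining
   equations of the product are the lemmas [diamondE_*] below. *)
Fixpoint diamond_tt (T : tree) : tree -> kF :=
  match T with
  | Bullet => fun T' => basis k (Sing T')
  | Graft F =>
      fix right (T' : tree) : kF :=
        match T' with
        | Bullet => basis k (Sing (Graft F))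
        | Graft F' =>
            graft (diamond_ft F (Graft F')) + graft (act_first right F')
            + lambda *: graft (act_first (diamond_ft F) F')
        end
  end
with diamond_ft (F : forest) (T' : tree) : kF :=
  match F with
  | Sing T => diamond_tt T T'
  | Cons T F0 => basis k (Sing T) |_| diamond_ft F0 T'
  end.

Definition diamond : kF -> kF -> kF :=
  bilin_ext (fun F F' => act_first (diamond_ft F) F').

Local Notation "u <o> v" := (diamond u v) (at level 40, left associativity).
Local Notation e := (basis k).

Lemma diamondE_tree_bullet T : e (Sing T) <o> e (Sing Bullet) = e (Sing T).
Proof. by rewrite /diamond bilin_ext_basis; case: T. Qed.

Lemma diamondE_bullet_tree T : e (Sing Bullet) <o> e (Sing T) = e (Sing T).
Proof. by rewrite /diamond bilin_ext_basis. Qed.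

Lemma diamondE_graft F F' :
  graft (e F) <o> graft (e F') =
    graft (e F <o> graft (e F')) + graft (graft (e F) <o> e F')
    + lambda *: graft (e F <o> e F').
Proof.
have graftE G : graft (e G) = e (Sing (Graft G)) by exact: lin_ext_basis.
by rewrite !graftE /diamond !bilin_ext_basis.
Qed.

Lemma diamondE_last F T T' :
  e (Cons T F) <o> e (Sing T') = e (Sing T) |_| (e F <o> e (Sing T')).
Proof. by rewrite /diamond !bilin_ext_basis. Qed.

Lemma diamondE_first F T' F' :
  e F <o> e (Cons T' F') = (e F <o> e (Sing T')) |_| e F'.
Proof. by rewrite /diamond !bilin_ext_basis. Qed.

(* The factors V_i of a forest: trees, and the two-bullet forest. *)
Inductive factor := FTree of tree | FTwoBullets.

Definition factor_forest (V : factor) : forest :=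
  match V with
  | FTree T => Sing T
  | FTwoBullets => Cons Bullet (Sing Bullet)
  end.

Fixpoint factors (F : forest) : seq factor :=
  match F with
  | Sing T => [:: FTree T]
  | Cons T F0 => [:: FTree T, FTwoBullets & factors F0]
  end.

Lemma diamond_factors F :
  \big[diamond/(e (Sing Bullet))]_(V <- factors F) e (factor_forest V) = e F.
Proof.
have catE G G' : e G |_| e G' = e (fcat G G') by exact: bilin_ext_basis.
elim: F => [T|T F IH] /=; first by rewrite unlock /= diamondE_tree_bullet.
rewrite unlock /= in IH *; rewrite {}IH.
have -> : e (Cons Bullet (Sing Bullet)) <o> e F = e (Cons Bullet F).
  by case: F => [T0|T0 F0]; rewrite ?diamondE_first diamondE_last
    diamondE_bullet_tree !catE.
by rewrite diamondE_first diamondE_tree_bullet catE.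
Qed.

Definition d_factor (V : factor) : kF :=
  match V with
  | FTree Bullet => 0
  | FTree (Graft F) => e F
  | FTwoBullets => e (Sing Bullet)
  end.

(* The iterated product is bracketed to the right and ends with the unit. *)
Definition d_basis (F : forest) : kF :=
  \sum_(I : {set 'I_(size (factors F))} | I != set0)
    lambda ^+ (#|I|.-1) *:
    \big[diamond/(e (Sing Bullet))]_(i < size (factors F))
      (let V := tnth (in_tuple (factors F)) i in
       if i \in I then d_factor V else e (factor_forest V)).

Definition d_forest : kF -> kF := lin_ext d_basis.

Lemma diamond0l u : 0 <o> u = 0.
Proof. by rewrite /diamond /bilin_ext /lin_ext msupp0 big_seq_fset0. Qed.

Lemma diamond0r u : u <o> 0 = 0.
Proof.
rewrite /diamond /bilin_ext /lin_ext big1 // => F _.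
by rewrite msupp0 big_seq_fset0 scaler0.
Qed.

(* The general formula agrees with the prescribed values on the factors. *)
Lemma d_forest_factor V : d_forest (e (factor_forest V)) = d_factor V.
Proof.
rewrite /d_forest lin_ext_basis /d_basis.
case: V => [T|] /=.
  rewrite (bigD1 [set: 'I_1]) /=; last by apply/set0Pn; exists ord0.
  rewrite big1 ?addr0 => [|I /andP[/set0Pn[i iI]]]; last first.
    by case/eqP; apply/setP=> j; rewrite inE (ord1 j) -(ord1 i).
  rewrite cardsT card_ord expr0 scale1r big_ord_recl big_ord0 inE /=.
  case: T => [|F]; first exact: diamond0l.
  by rewrite /diamond bilin_ext_basis; elim: F => [[]|? ? /= ->] //;
     rewrite /sqcup bilin_ext_basis.
pose i1 : 'I_3 := inord 1.
rewrite (bigD1 [set i1]) /=; last by apply/set0Pn; exists i1; rewrite inE.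
rewrite big1 ?addr0 => [|I /andP[I0 I1]]; last first.
  rewrite !big_ord_recl big_ord0 /=.
  case: ifP => [_|I0f]; first by rewrite diamond0l scaler0.
  case: (boolP (lift ord0 (lift ord0 ord0) \in I)) => [_|I2f].
    by rewrite diamond0l !diamond0r scaler0.
  case/eqP: I1; apply/eqP; rewrite eqEsubset sub1set.
  have sI : I \subset [set i1].
    apply/subsetP=> -[[|[|[|//]]] ltj] jI; rewrite inE.
    - by rewrite (_ : Ordinal ltj = ord0) ?I0f in jI; last exact/val_inj.
    - by apply/eqP/val_inj; rewrite /= inordK.
    - by case/negP: I2f; rewrite (_ : Ordinal ltj = lift ord0 (lift ord0 ord0)) in jI;
         last exact/val_inj.
  rewrite sI /=; case/set0Pn: I0 => j jI.
  by have := subsetP sI _ jI; rewrite inE => /eqP <-.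
rewrite cards1 expr0 scale1r !big_ord_recl big_ord0 !inE /= -!val_eqE /= inordK //=.
by rewrite !diamondE_bullet_tree.
Qed.

End Diamond.

Section DifferentialRotaBaxter.
Variables (k : comPzRingType) (lambda : k) (A : lmodType k).
Variables (mul : A -> A -> A) (one : A) (d P : A -> A).

Record unital_algebra : Prop := UnitalAlgebra {
  ua_mulA : associative mul;
  ua_mul1l : left_id one mul;
  ua_mul1r : right_id one mul;
  ua_mul_linear_r : forall x, linear (mul x);
  ua_mul_linear_l : forall y, linear (mul^~ y)
}.

Record differential_Rota_Baxter : Prop := DifferentialRotaBaxter {
  drb_algebra : unital_algebra;
  drb_d_linear : linear d;
  drb_P_linear : linear P;
  drb_d_mul : forall x y,
    d (mul x y) = mul (d x) y + mul x (d y) + lambda *: mul (d x) (d y);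
  drb_d_one : d one = 0;
  drb_P_mul : forall x y,
    mul (P x) (P y) = P (mul x (P y)) + P (mul (P x) y) + lambda *: P (mul x y);
  drb_d_P : forall x, d (P x) = x
}.

End DifferentialRotaBaxter.

(* Main.v *)
(* The product is determined by (x |_| y) <> z = x |_| (y <> z) and
   x <> (y |_| z) = (x <> y) |_| z together with its values on trees. These two
   rules reduce associativity to three grafted trees, where it follows from the
   Rota-Baxter identity by induction on the number of vertices.

   With B the forest of two bullets, a tree T followed by a forest F is
   T <> (B <> F). Splitting the subset sum defining d according to whether the
   first factors lie in the subset shows that the Leibniz rule holds for the
   pairs (T, B <> F) and (B, F); for two grafted trees it amounts to the
   Rota-Baxter identity, since d is a left inverse of grafting. The rule then
   propagates to all pairs: once it holds for (x, y) and (y, z), it holds for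
   (x <> y, z) if and only if it holds for (x, y <> z). *)

From mathcomp Require Import all_boot all_algebra finmap ring zify.
Require Import Defs.

Set Implicit Arguments.
Unset Strict Implicit.
Unset Printing Implicit Defensive.

Import GRing.Theory.
Local Open Scope ring_scope.

Lemma fcatA : associative fcat.
Proof. by elim=> [T|T F IH] G H //=; rewrite IH. Qed.

(** Subsets are sorted by whether they contain [ord0]; this peels the first factor off the subset
    sum defining the differential operator. *)
Lemma big_set_ordS (V : nmodType) n (f : {set 'I_n.+1} -> V) :
  \sum_I f I =
    \sum_(J : {set 'I_n}) f (lift ord0 @: J)
    + \sum_(J : {set 'I_n}) f (ord0 |: (lift ord0 @: J)).
Proof.
have preK (I : {set 'I_n}) : lift ord0 @^-1: (lift ord0 @: I) = I.
  by apply/setP=> j; rewrite inE mem_imset //; apply: lift_inj.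
have ord0N (J : {set 'I_n}) : ord0 \notin lift ord0 @: J.
  by apply/imsetP=> -[j _ /eqP]; rewrite (negPf (neq_lift _ _)).
rewrite (bigID (fun I : {set 'I_n.+1} => ord0 \in I)) [LHS]addrC /=.
congr (_ + _).
  rewrite (reindex_onto (fun J : {set 'I_n} => lift ord0 @: J)
                        (fun I => lift ord0 @^-1: I)) /=.
    by apply: eq_bigl => J; rewrite ord0N preK eqxx.
  move=> I I0; apply/setP=> i; case: (unliftP ord0 i) => [j|] ->.
    by rewrite mem_imset ?inE //; apply: lift_inj.
  by rewrite (negPf I0) (negPf (ord0N _)).
rewrite (reindex_onto (fun J : {set 'I_n} => ord0 |: (lift ord0 @: J))
                      (fun I => lift ord0 @^-1: I)) /=.
  apply: eq_bigl => J; rewrite setU11 -[X in _ == X]preK /=; apply/eqP/setP=> j.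
  by rewrite !inE eq_sym (negPf (neq_lift _ _)).
move=> I I0; apply/setP=> i; rewrite in_setU1.
case: (unliftP ord0 i) => [j|] ->; last by rewrite eqxx.
by rewrite eq_sym (negPf (neq_lift _ _)) mem_imset ?inE //; apply: lift_inj.
Qed.

(** * Linear and bilinear extension from the basis of forests *)

Section Linearity.
Variable k : comPzRingType.
Local Notation kF := (kforest k).
Local Notation e := (basis k).

Lemma mcoeff_kforestD F : {morph mcoeff F : u v / u + v : kF >-> u + v : k}.
Proof. by move=> u v; rewrite mcoeffD. Qed.

Lemma mcoeff_kforestZ (c : k) (u : kF) F : (c *: u)@_F = c * u@_F.
Proof. exact: kforest_scaleE. Qed.

(** Allows elements with different supports to be summed over a common index set. *)
Lemma lin_extEw (D : {fset forest}) (f : forest -> kF) (u : kF) :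
  (msupp u `<=` D)%fset -> lin_ext f u = \sum_(F <- D) u@_F *: f F.
Proof.
move=> suD; apply: big_fset_incl => // F _ /mcoeff_outdom ->.
by rewrite scale0r.
Qed.

Lemma lin_extD f : {morph lin_ext f : u v / u + v : kF}.
Proof.
move=> u v; pose D := (msupp u `|` msupp v)%fset.
rewrite !(@lin_extEw D) ?fsubsetUl ?fsubsetUr ?msuppD_le //.
by rewrite -big_split; apply: eq_bigr => F _; rewrite mcoeff_kforestD scalerDl.
Qed.

Lemma lin_extZ f (c : k) (u : kF) : lin_ext f (c *: u) = c *: lin_ext f u.
Proof.
rewrite (@lin_extEw (msupp u)); last first.
  apply/fsubsetP=> F; rewrite -!mcoeff_neq0 mcoeff_kforestZ.
  by apply: contraNneq => ->; rewrite mulr0.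
by rewrite scaler_sumr; apply: eq_bigr => F _; rewrite mcoeff_kforestZ scalerA.
Qed.

Lemma bilin_extDl f (v : kF) : {morph (bilin_ext f)^~ v : u w / u + w}.
Proof. by move=> u w; apply: lin_extD. Qed.

Lemma bilin_extZl f (c : k) (u v : kF) :
  bilin_ext f (c *: u) v = c *: bilin_ext f u v.
Proof. exact: lin_extZ. Qed.

Lemma bilin_extDr f (u : kF) : {morph bilin_ext f u : v w / v + w}.
Proof.
move=> v w; rewrite -big_split; apply: eq_bigr => F _ /=.
by rewrite lin_extD scalerDr.
Qed.

Lemma bilin_extZr f (c : k) (u v : kF) :
  bilin_ext f u (c *: v) = c *: bilin_ext f u v.
Proof.
rewrite scaler_sumr; apply: eq_bigr => F _.
by rewrite lin_extZ !scalerA mulrC.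
Qed.

Lemma kforest_ind (p : kF -> Prop) :
  (forall F, p (e F)) -> (forall u v, p u -> p v -> p (u + v)) ->
  (forall c u, p u -> p (c *: u)) -> forall u, p u.
Proof.
move=> pe pD pZ u; have -> : u = \sum_(F <- msupp u) u@_F *: e F.
  rewrite {1}[u]monalgE; apply: eq_bigr => F _; apply/malgP=> G.
  by rewrite mcoeff_kforestZ !mcoeffU mulrnAr mulr1.
apply: big_ind => [||F _]; [|exact: pD|exact/pZ/pe].
by rewrite -(scale0r (e (Sing Bullet))); apply/pZ/pe.
Qed.

End Linearity.

(* Module identities hold because they hold coefficientwise in the scalars. *)
Ltac kforest_ring :=
  apply/malgP=> ?; rewrite !(mcoeff_kforestD, mcoeff_kforestZ); ring.

Section Algebra.
Variables (k : comPzRingType) (lambda : k).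
Local Notation kF := (kforest k).
(* The operations are locked: unification otherwise tries to decide equalities
   of forests by unfolding finitely supported functions. *)
Local Notation e := (locked (basis k)).
Local Notation P := (locked (@graft k)).
Local Notation one := (e (Sing Bullet)).
Local Notation "u <o> v" := (locked (diamond lambda) u v)
  (at level 40, left associativity).
Local Notation "u '|_|' v" := (locked (@sqcup k) u v)
  (at level 50, left associativity).

Lemma graftD u v : P (u + v) = P u + P v.
Proof. by rewrite -!lock; apply: lin_extD. Qed.
Lemma graftZ c u : P (c *: u) = c *: P u.
Proof. by rewrite -!lock; apply: lin_extZ. Qed.
Lemma graft_basis F : P (e F) = e (Sing (Graft F)).
Proof. by rewrite -!lock; apply: lin_ext_basis. Qed.

Lemma sqcupDl u v w : (u + v) |_| w = (u |_| w) + (v |_| w).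
Proof. by rewrite -!lock; apply: bilin_extDl. Qed.
Lemma sqcupDr u v w : u |_| (v + w) = (u |_| v) + (u |_| w).
Proof. by rewrite -!lock; apply: bilin_extDr. Qed.
Lemma sqcupZl c u v : (c *: u) |_| v = c *: (u |_| v).
Proof. by rewrite -!lock; apply: bilin_extZl. Qed.
Lemma sqcupZr c u v : u |_| (c *: v) = c *: (u |_| v).
Proof. by rewrite -!lock; apply: bilin_extZr. Qed.
Lemma sqcup_basis F G : e F |_| e G = e (fcat F G).
Proof. by rewrite -!lock; apply: bilin_ext_basis. Qed.

Lemma diamondDl u v w : (u + v) <o> w = u <o> w + v <o> w.
Proof. by rewrite -!lock; apply: bilin_extDl. Qed.
Lemma diamondDr u v w : u <o> (v + w) = u <o> v + u <o> w.
Proof. by rewrite -!lock; apply: bilin_extDr. Qed.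
Lemma diamondZl c u v : (c *: u) <o> v = c *: (u <o> v).
Proof. by rewrite -!lock; apply: bilin_extZl. Qed.
Lemma diamondZr c u v : u <o> (c *: v) = c *: (u <o> v).
Proof. by rewrite -!lock; apply: bilin_extZr. Qed.

Lemma diamond_tree_bullet T : e (Sing T) <o> one = e (Sing T).
Proof. by rewrite -!lock; apply: diamondE_tree_bullet. Qed.
Lemma diamond_bullet_tree T : one <o> e (Sing T) = e (Sing T).
Proof. by rewrite -!lock; apply: diamondE_bullet_tree. Qed.
Lemma diamond_last F T T' :
  e (Cons T F) <o> e (Sing T') = e (Sing T) |_| (e F <o> e (Sing T')).
Proof. by rewrite -!lock; apply: diamondE_last. Qed.
Lemma diamond_first F T' F' :
  e F <o> e (Cons T' F') = (e F <o> e (Sing T')) |_| e F'.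
Proof. by rewrite -!lock; apply: diamondE_first. Qed.

Definition linE := (diamondDl, diamondDr, diamondZl, diamondZr, sqcupDl,
  sqcupDr, sqcupZl, sqcupZr, graftD, graftZ).

Lemma span_ind (p : kF -> Prop) :
  (forall F, p (e F)) -> (forall u v, p u -> p v -> p (u + v)) ->
  (forall c u, p u -> p (c *: u)) -> forall u, p u.
Proof. by rewrite -lock; apply: kforest_ind. Qed.

(** * Concatenation, product and associativity *)

Lemma sqcupA : associative (locked (@sqcup k)).
Proof.
move=> u v w.
elim/span_ind: u => [F|u1 u2 IH1 IH2|c u IH]; last 2 first.
- by rewrite !linE IH1 IH2.
- by rewrite !linE IH.
elim/span_ind: v => [G|u1 u2 IH1 IH2|c u IH]; last 2 first.
- by rewrite !linE IH1 IH2.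
- by rewrite !linE IH.
elim/span_ind: w => [H|u1 u2 IH1 IH2|c u IH]; last 2 first.
- by rewrite !linE IH1 IH2.
- by rewrite !linE IH.
by rewrite !sqcup_basis fcatA.
Qed.

Lemma diamond1l : left_id one (locked (diamond lambda)).
Proof.
elim/span_ind=> [F|u v IHu IHv|c u IH]; last 2 first.
- by rewrite linE IHu IHv.
- by rewrite linE IH.
case: F => [T|T F]; first exact: diamond_bullet_tree.
by rewrite diamond_first diamond_bullet_tree sqcup_basis.
Qed.

Lemma diamond1r : right_id one (locked (diamond lambda)).
Proof.
elim/span_ind=> [F|u v IHu IHv|c u IH]; last 2 first.
- by rewrite linE IHu IHv.
- by rewrite linE IH.
elim: F => [T|T F IH]; first exact: diamond_tree_bullet.
by rewrite diamond_last IH sqcup_basis.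
Qed.

(** The product modifies only the first tree of its right factor, so whatever is concatenated behind
    that factor stays untouched. *)
Lemma diamond_sqcupr u v w : u <o> (v |_| w) = (u <o> v) |_| w.
Proof.
elim/span_ind: u => [F|u1 u2 IH1 IH2|c u IH]; last 2 first.
- by rewrite !linE IH1 IH2.
- by rewrite !linE IH.
elim/span_ind: v => [G|u1 u2 IH1 IH2|c u IH]; last 2 first.
- by rewrite !linE IH1 IH2.
- by rewrite !linE IH.
elim/span_ind: w => [H|u1 u2 IH1 IH2|c u IH]; last 2 first.
- by rewrite !linE IH1 IH2.
- by rewrite !linE IH.
rewrite sqcup_basis; case: G => [T|T G] /=; rewrite diamond_first //.
by rewrite -sqcup_basis sqcupA -diamond_first.
Qed.

Lemma diamond_sqcupl u v w : (u |_| v) <o> w = u |_| (v <o> w).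
Proof.
elim/span_ind: u => [F|u1 u2 IH1 IH2|c u IH]; last 2 first.
- by rewrite !linE IH1 IH2.
- by rewrite !linE IH.
elim/span_ind: v => [G|u1 u2 IH1 IH2|c u IH]; last 2 first.
- by rewrite !linE IH1 IH2.
- by rewrite !linE IH.
elim/span_ind: w => [H|u1 u2 IH1 IH2|c u IH]; last 2 first.
- by rewrite !linE IH1 IH2.
- by rewrite !linE IH.
(* The defining equation covers a single tree on the right; here it is extended to any forest. *)
have consl T F' G' : e (Cons T F') <o> e G' = e (Sing T) |_| (e F' <o> e G').
  case: G' => [T'|T' G']; first exact: diamond_last.
  by rewrite !diamond_first diamond_last sqcupA.
rewrite sqcup_basis; elim: F => [T|T F IH] /=; rewrite consl //.
by rewrite IH sqcupA sqcup_basis.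
Qed.

Lemma diamond_graft u v :
  P u <o> P v = P (u <o> P v) + P (P u <o> v) + lambda *: P (u <o> v).
Proof.
elim/span_ind: u => [F|u1 u2 IH1 IH2|c u IH]; last 2 first.
- by rewrite !linE IH1 IH2; kforest_ring.
- by rewrite !linE IH; kforest_ring.
elim/span_ind: v => [G|v1 v2 IH1 IH2|c v IH]; last 2 first.
- by rewrite !linE IH1 IH2; kforest_ring.
- by rewrite !linE IH; kforest_ring.
by rewrite -!lock; apply: diamondE_graft.
Qed.

(* Both bracketings expand to the sum of the terms P(u'v'w'), where u', v', w'
   are u, v, w with at least one argument outside P, with coefficient lambda to
   the number of arguments outside P minus one. *)
Lemma diamond_graftA u v w :
    u <o> (P v <o> P w) = u <o> P v <o> P w ->
    P u <o> (v <o> P w) = P u <o> v <o> P w ->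
    P u <o> (P v <o> w) = P u <o> P v <o> w ->
    u <o> (v <o> P w) = u <o> v <o> P w ->
    u <o> (P v <o> w) = u <o> P v <o> w ->
    P u <o> (v <o> w) = P u <o> v <o> w ->
    u <o> (v <o> w) = u <o> v <o> w ->
  P u <o> (P v <o> P w) = P u <o> P v <o> P w.
Proof.
rewrite !(diamond_graft, linE) => A1 A2 A3 A4 A5 A6 A7.
rewrite A2 A3 A4 A5 A6 A7.
(* The first hypothesis, once expanded, is solved for one term. The sign is a scaling by -1 so that
   [linE] distributes over it. *)
have -> : u <o> P (v <o> P w) = u <o> P v <o> P w
    + (-1) *: (u <o> P (P v <o> w) + lambda *: (u <o> P (v <o> w))).
  by rewrite -A1; kforest_ring.
by rewrite !linE; kforest_ring.
Qed.

Fixpoint tree_size (T : tree) : nat :=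
  match T with Bullet => 1 | Graft F => (forest_size F).+1 end
with forest_size (F : forest) : nat :=
  match F with
  | Sing T => tree_size T
  | Cons T F => tree_size T + forest_size F
  end.

Lemma tree_size_gt0 T : (0 < tree_size T)%N. Proof. by case: T. Qed.
Lemma forest_size_gt0 F : (0 < forest_size F)%N.
Proof. by case: F => [T|T F] /=; have := tree_size_gt0 T; lia. Qed.

Lemma diamond_basisA F G H : e F <o> (e G <o> e H) = e F <o> e G <o> e H.
Proof.
have [n] := ubnP (forest_size F + forest_size G + forest_size H).
elim: n F G H => // n IH F G H; rewrite ltnS => le_n.
have {}IH F' G' H' :
    (forest_size F' + forest_size G' + forest_size H' <
      forest_size F + forest_size G + forest_size H)%N ->
    e F' <o> (e G' <o> e H') = e F' <o> e G' <o> e H'.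
  by move=> lt; apply: IH; apply: leq_trans le_n.
have consE T K : e (Cons T K) = e (Sing T) |_| e K by rewrite sqcup_basis.
case: F IH {le_n} => [T|T F] IH; last first.
  by rewrite consE !diamond_sqcupl IH //=; have := tree_size_gt0 T; lia.
case: H IH => [T3|T3 H] IH; last first.
  rewrite consE !diamond_sqcupr IH //=.
  by have := forest_size_gt0 H; lia.
(* When the middle forest has several trees, the outer factors act on its two ends separately, so
   the bracketings agree at once. *)
case: G IH => [T2|T2 G] IH; last first.
  by rewrite consE !(diamond_sqcupl, diamond_sqcupr) ?diamond_sqcupl.
(* A bullet is a unit. For three graftings, each hypothesis of [diamond_graftA] drops at least one
   root, so the induction applies. *)
case: T T2 T3 IH => [|F] [|G] [|H] IH; rewrite ?diamond1l ?diamond1r //.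
rewrite -!graft_basis; apply: diamond_graftA; rewrite ?graft_basis;
  by apply: IH => /=; lia.
Qed.

Lemma diamondA : associative (locked (diamond lambda)).
Proof.
move=> u v w.
elim/span_ind: u => [F|u1 u2 IH1 IH2|c u IH]; last 2 first.
- by rewrite !linE IH1 IH2.
- by rewrite !linE IH.
elim/span_ind: v => [G|u1 u2 IH1 IH2|c u IH]; last 2 first.
- by rewrite !linE IH1 IH2.
- by rewrite !linE IH.
elim/span_ind: w => [H|u1 u2 IH1 IH2|c u IH]; last 2 first.
- by rewrite !linE IH1 IH2.
- by rewrite !linE IH.
exact: diamond_basisA.
Qed.

(** * The operator [d] as a subset sum *)

Local Notation d := (locked (d_forest lambda)).
Local Notation dvalue V := (locked (@d_factor k) V).
Local Notation fvalue V := (e (factor_forest V)).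
Local Notation B := (e (Cons Bullet (Sing Bullet))).

Lemma dD u v : d (u + v) = d u + d v.
Proof. by rewrite -!lock; apply: lin_extD. Qed.
Lemma dZ c u : d (c *: u) = c *: d u.
Proof. by rewrite -!lock; apply: lin_extZ. Qed.

Lemma d_factorE V : d (fvalue V) = dvalue V.
Proof. by rewrite -!lock d_forest_factor. Qed.

(** The coefficient is left arbitrary because removing a first factor that lies in the subset shifts
    the cardinality by one. *)
Definition subset_sum (c : nat -> k) (s : seq factor) : kF :=
  \sum_(I : {set 'I_(size s)}) c #|I| *:
    \big[locked (diamond lambda)/one]_(i < size s)
      (let V := tnth (in_tuple s) i in
       if i \in I then dvalue V else fvalue V).

Lemma subset_sum_cons c V s :
  subset_sum c (V :: s) =
    fvalue V <o> subset_sum c s + dvalue V <o> subset_sum (c \o succn) s.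
Proof.
have diamond_sumr (I : finType) (u : kF) (v : I -> kF) :
    u <o> (\sum_i v i) = \sum_i u <o> v i.
  apply: (big_morph (locked (diamond lambda) u) (diamondDr u)).
  by rewrite -!lock diamond0r.
have tnthS j : tnth (in_tuple (V :: s)) (lift ord0 j) = tnth (in_tuple s) j.
  by rewrite !(tnth_nth V).
rewrite /subset_sum big_set_ordS !diamond_sumr.
congr (_ + _); apply: eq_bigr => J _; rewrite big_ord_recl diamondZr.
  rewrite card_imset; last exact: lift_inj.
  have /negPf -> : ord0 \notin lift ord0 @: J.
    by apply/imsetP=> -[j _ /eqP]; rewrite (negPf (neq_lift _ _)).
  congr (_ *: (_ <o> _)); apply: eq_bigr => j _.
  by rewrite mem_imset ?tnthS //; apply: lift_inj.
rewrite cardsU1 card_imset; last exact: lift_inj.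
have /negPf N0 : ord0 \notin lift ord0 @: J.
  by apply/imsetP=> -[j _ /eqP]; rewrite (negPf (neq_lift _ _)).
rewrite setU11 N0 add1n; congr (_ *: (_ <o> _)); apply: eq_bigr => j _.
rewrite in_setU1 eq_sym (negPf (neq_lift _ _)) mem_imset ?tnthS //.
exact: lift_inj.
Qed.

(** The value 0 at 0 encodes the exclusion of the empty subset. *)
Definition d_coef (n : nat) : k := if n is m.+1 then lambda ^+ m else 0.

Lemma d_basisE F : d (e F) = subset_sum d_coef (factors F).
Proof.
rewrite /subset_sum -!lock /d_forest lin_ext_basis /d_basis big_mkcond.
apply: eq_bigr => I _; rewrite -cards_eq0.
by case: #|I| => [|m]; rewrite ?scale0r.
Qed.

(** The weight [lambda ^+ n] is the indicator of [n = 0] plus [lambda * d_coef n], and the indicator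
    keeps only the undifferentiated product. *)
Lemma subset_sum_exp s :
  subset_sum (fun n => lambda ^+ n) s =
    \big[locked (diamond lambda)/one]_(V <- s) fvalue V
    + lambda *: subset_sum d_coef s.
Proof.
have -> : \big[locked (diamond lambda)/one]_(V <- s) fvalue V
          = subset_sum (fun n => (n == 0)%:R) s.
  rewrite /subset_sum (bigD1 set0) //= cards0 scale1r [X in _ + X]big1.
    by rewrite addr0 big_tnth; apply: eq_bigr => i _; rewrite in_set0.
  by move=> I; rewrite -cards_eq0 => /negPf ->; rewrite scale0r.
rewrite scaler_sumr -big_split; apply: eq_bigr => I _ /=.
rewrite scalerA -scalerDl; congr (_ *: _).
by case: #|I| => [|m]; rewrite ?mulr0 ?addr0 ?add0r ?exprS.
Qed.

(** The factors [T] and then [B] are peeled off the subset sum; [D] is the sum for the factors of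
    [F] preceded by [B]. *)
Lemma d_cons T F (D := B <o> d (e F) + e F + lambda *: d (e F)) :
  d (e (Cons T F)) =
    e (Sing T) <o> D + d (e (Sing T)) <o> (B <o> e F + lambda *: D).
Proof.
have facE : \big[locked (diamond lambda)/one]_(V <- factors F) fvalue V = e F.
  by rewrite -!lock diamond_factors.
have dB : dvalue FTwoBullets = one by rewrite -!lock.
have DE : subset_sum d_coef (FTwoBullets :: factors F) = D.
  (* [d_coef \o succn] computes to the powers of [lambda]. *)
  rewrite subset_sum_cons dB diamond1l [subset_sum (_ \o _) _]subset_sum_exp.
  by rewrite facE -d_basisE addrA.
rewrite d_basisE [factors _]/= subset_sum_cons.
rewrite [subset_sum (_ \o _) _]subset_sum_exp big_cons facE DE.
by rewrite (d_factorE (FTree T)).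
Qed.

(** * The Leibniz rule *)

Definition leibniz u v :=
  d (u <o> v) = d u <o> v + u <o> d v + lambda *: (d u <o> d v).

Lemma leibnizDl u v w : leibniz u w -> leibniz v w -> leibniz (u + v) w.
Proof. by rewrite /leibniz !(linE, dD) => -> ->; kforest_ring. Qed.
Lemma leibnizDr u v w : leibniz u v -> leibniz u w -> leibniz u (v + w).
Proof. by rewrite /leibniz !(linE, dD) => -> ->; kforest_ring. Qed.
Lemma leibnizZl c u v : leibniz u v -> leibniz (c *: u) v.
Proof. by rewrite /leibniz !(linE, dZ) => ->; kforest_ring. Qed.
Lemma leibnizZr c u v : leibniz u v -> leibniz u (c *: v).
Proof. by rewrite /leibniz !(linE, dZ) => ->; kforest_ring. Qed.

(** Both right-hand sides expand to the same seven terms, one for each non-empty choice of the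
    factors to which [d] is applied. *)
Lemma leibnizA u v w :
  leibniz u v -> leibniz v w -> leibniz (u <o> v) w <-> leibniz u (v <o> w).
Proof.
rewrite /leibniz !diamondA => -> ->; rewrite !linE !diamondA.
by split=> ->; kforest_ring.
Qed.

Lemma d_one : d one = 0.
Proof. by rewrite (d_factorE (FTree Bullet)) -!lock. Qed.

Lemma d_graft u : d (P u) = u.
Proof.
elim/span_ind: u => [F|u v IHu IHv|c u IH]; last 2 first.
- by rewrite linE dD IHu IHv.
- by rewrite linE dZ IH.
by rewrite graft_basis (d_factorE (FTree (Graft F))) -!lock.
Qed.

Lemma diamond_zerol u : 0 <o> u = 0.
Proof. by rewrite -!lock diamond0l. Qed.
Lemma diamond_zeror u : u <o> 0 = 0.
Proof. by rewrite -!lock diamond0r. Qed.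

Lemma leibniz_onel u : leibniz one u.
Proof.
by rewrite /leibniz d_one !diamond1l !diamond_zerol scaler0 add0r addr0.
Qed.

Lemma leibniz_oner u : leibniz u one.
Proof.
by rewrite /leibniz d_one !diamond1r !diamond_zeror scaler0 !addr0.
Qed.

Lemma leibniz_graft u v : leibniz (P u) (P v).
Proof.
by rewrite /leibniz diamond_graft !(dD, dZ) !d_graft [u <o> P v + _]addrC.
Qed.

Lemma diamond_BE F : B <o> e F = e (Cons Bullet F).
Proof.
by rewrite -(sqcup_basis (Sing _)) diamond_sqcupl diamond1l sqcup_basis.
Qed.

Lemma diamond_consE T F : e (Cons T F) = e (Sing T) <o> (B <o> e F).
Proof.
rewrite diamond_BE -(sqcup_basis (Sing Bullet)) diamond_sqcupr diamond1r.
by rewrite sqcup_basis.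
Qed.

Lemma d_diamond_B F : d (B <o> e F) = B <o> d (e F) + e F + lambda *: d (e F).
Proof.
by rewrite diamond_BE d_cons d_one diamond1l diamond_zerol addr0.
Qed.

Lemma leibniz_B u : leibniz B u.
Proof.
elim/span_ind: u => [F|u v|c u]; [|exact: leibnizDr|exact: leibnizZr].
rewrite /leibniz d_diamond_B (d_factorE FTwoBullets).
have -> : dvalue FTwoBullets = one by rewrite -!lock.
by rewrite !diamond1l; kforest_ring.
Qed.

Lemma leibniz_tree_B T u : leibniz (e (Sing T)) (B <o> u).
Proof.
elim/span_ind: u => [F|u v IHu IHv|c u IH]; last 2 first.
- by rewrite linE; apply: leibnizDr.
- by rewrite linE; apply: leibnizZr.
rewrite /leibniz -diamond_consE d_cons -d_diamond_B !linE.
by kforest_ring.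
Qed.

Lemma leibniz_graft_B u v : leibniz (P u) (B <o> v).
Proof.
elim/span_ind: u => [F|u w IHu IHw|c u IH]; last 2 first.
- by rewrite linE; apply: leibnizDl.
- by rewrite linE; apply: leibnizZl.
by rewrite graft_basis; apply: leibniz_tree_B.
Qed.

(** By the Rota-Baxter identity a product of two trees is a tree or a linear combination of
    graftings. *)
Lemma leibniz_trees_B T T' u :
  leibniz (e (Sing T) <o> e (Sing T')) (B <o> u).
Proof.
case: T T' => [|F] [|G]; rewrite ?diamond1l ?diamond1r;
  try exact: leibniz_tree_B.
rewrite -!graft_basis diamond_graft.
by do !apply: leibnizDl; last apply: leibnizZl; apply: leibniz_graft_B.
Qed.

Lemma leibniz_tree T u : leibniz (e (Sing T)) u.
Proof.
elim/span_ind: u => [G|u v|c u]; [|exact: leibnizDr|exact: leibnizZr].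
have tt T' : leibniz (e (Sing T)) (e (Sing T')).
  case: T T' => [|F] [|G']; try exact: leibniz_onel; try exact: leibniz_oner.
  by rewrite -!graft_basis; apply: leibniz_graft.
case: G => [T'|T' G] //; rewrite diamond_consE.
(* Moves [T'] from the right argument to the left one, leaving the pair of [T <o> T'] and
   [B <o> G]. *)
apply/leibnizA => //; first exact: leibniz_tree_B.
exact: leibniz_trees_B.
Qed.

Lemma leibniz_all u v : leibniz u v.
Proof.
elim/span_ind: u => [F|u w|c u]; [|exact: leibnizDl|exact: leibnizZl].
elim: F => [T|T F IH]; first exact: leibniz_tree.
rewrite diamond_consE; have ? := leibniz_tree T; have ? := leibniz_B.
(* The outer use splits off [T]; the inner one derives the rule for [B <o> F] from those for [B] and
   [F]. *)
by apply/leibnizA => //; apply/leibnizA.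
Qed.

End Algebra.

Theorem theorem5p1 (k : comPzRingType) (lambda : k) :
  differential_Rota_Baxter lambda
    (diamond lambda) (basis k (Sing Bullet)) (d_forest lambda) (@graft k).
Proof.
have [mulA mul1 mulr1] := And3 (@diamondA k lambda) (@diamond1l k lambda)
  (@diamond1r k lambda).
have d_mul := @leibniz_all k lambda; have P_mul := @diamond_graft k lambda.
have dP := @d_graft k lambda; have d1 := @d_one k lambda.
rewrite /leibniz -!lock in mulA mul1 mulr1 d_mul P_mul dP d1.
split=> //; last 2 first.
- by move=> c u v; rewrite /d_forest lin_extD lin_extZ.
- by move=> c u v; rewrite /graft lin_extD lin_extZ.
split=> // [u c v w|u c v w].
  by rewrite /diamond bilin_extDr bilin_extZr.
by rewrite /diamond bilin_extDl bilin_extZl.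
Qed.
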